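(* Let $G$ be a graph and let $F:V(G)\to 2^{\mathbb N}$. If $G$ has an orientation $D$ such that \[|F(v)|\le \tfrac{2}{3}\deg^+_D(v)-1\] for each $v\in V(G)$, then $G$ has an $F$-avoiding orientation.
   Context: For an orientation $D$ of $G$, $\deg^+_D(v)$ denotes the out-degree of $v$ in $D$. Given $F:V(G)\to 2^{\mathbb N}$ (a set of forbidden values at each vertex), an orientation $D'$ of $G$ is $F$-avoiding if $\deg^+_{D'}(v)\notin F(v)$ for every $v\in V(G)$. *)

(* Defs.v *)
From mathcomp Require Import all_boot all_order all_algebra finmap.
From mathcomp Require Import classical_sets cardinality.

Set Implicit Arguments.
Unset Strict Implicit.
Unset Printing Implicit Defensive.

(* A finite simple graph is a symmetric irreflexive adjacency relation [e] on a
   finite type of vertices; in a digraph [D], [D u v] is the arc from u to v. *)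

Definition orientation (T : finType) (e D : rel T) : Prop :=
  subrel D e /\ forall u v : T, e u v -> D u v (+) D v u.

Definition outdeg (T : finType) (D : rel T) (v : T) : nat := #|D v|.

Definition avoiding (T : finType) (F : T -> set nat) (D : rel T) : Prop :=
  forall v : T, ~ F v (outdeg D v).

(* Main.v *)
Require Import Defs.
From mathcomp Require Import mpoly zify ring lra.
From mathcomp Require Import all_boot all_order all_algebra finmap.
From mathcomp Require Import classical_sets cardinality.
From mathcomp Require Import fintype finset.

(* Give every vertex w a variable E w and let Phi be the linear functional that
   sends the product of the E w ^+ t w to the product of all t w - c, c in F w.
   An orientation with outdegrees t avoids F as soon as Phi does not kill its
   monomial, so it suffices to find a combination of orientation monomials not
   killed by Phi.  In the augmentations E w - 1 the leading part of Phi is the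
   single monomial with exponents k w = #|F w|.

   Vertices are eliminated one at a time.  When v has remaining neighborhood N,
   the products of the factors E v - E w over the (k v + j)-subsets of N span,
   up to terms of the wrong degree, every squarefree monomial of degree j in the
   neighbors, provided k v + 2 j <= #|N| (the inclusion matrix has full rank).
   Hence eliminating v costs k v and lowers by one the exponents of any j
   prescribed neighbors ("gifts"), and the leading part stays a monomial.

   Always eliminate a vertex whose indegree in the remaining digraph is at most
   its outdegree.  Every in-neighbor loses one arc; two thirds of them can be
   given a gift, and by Hall's theorem this can be arranged so that every vertex
   also gets gifts for two thirds of the arcs it loses, which preserves
   k <= 2/3 deg^+ up to rounding. *)

Set Implicit Arguments.
Unset Strict Implicit.
Unset Printing Implicit Defensive.

Import Order.TTheory GRing.Theory Num.Theory.

Local Open Scope ring_scope.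

(** * Hall's theorem, and thinning a relation to one third *)

Definition neighbors (L R : finType) (E : L -> R -> bool) (A : {set L}) : {set R} :=
  [set y | [exists x in A, E x y]].

Lemma neighborsU (L R : finType) (E : L -> R -> bool) (A B : {set L}) :
  neighbors E (A :|: B) = neighbors E A :|: neighbors E B.
Proof.
apply/setP => y; rewrite !inE; apply/exists_inP/orP.
  by case=> x; rewrite inE => /orP[] xA Exy; [left|right];
     apply/exists_inP; exists x.
by case=> /exists_inP[x xA Exy]; exists x; rewrite // inE xA ?orbT.
Qed.

(* Halmos and Vaughan: either every proper part of A has a spare neighbor and
   one edge can be fixed greedily, or A splits at a tight part. *)
Lemma hall_marriage (L R : finType) (E : L -> R -> bool) (A : {set L}) :
  (forall S : {set L}, S \subset A -> #|S| <= #|neighbors E S|)%N ->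
  exists2 f : L -> option R,
    (forall x, x \in A -> exists2 y, f x = Some y & E x y) &
    {in A &, injective f}.
Proof.
have [n] := ubnP #|A|; elim: n => // n IH in A E *; rewrite ltnS => leAn hallA.
have [->|[x0 x0A]] := set_0Vmem A.
  by exists (fun=> None) => [x|x y]; rewrite inE.
case: (boolP [exists S : {set L},
         [&& S != set0, S \proper A & #|neighbors E S| <= #|S|]%N]); last first.
  rewrite negb_exists => /forallP spare.
  have [y Exy] : exists y, E x0 y.
    have := hallA [set x0]; rewrite sub1set x0A cards1 => /(_ isT).
    by rewrite card_gt0 => /set0Pn[y]; rewrite inE => /exists_inP[x /set1P-> ?]; exists y.
  pose E' x z := E x z && (z != y).
  have [|S sSA|f fE f_inj] := IH (A :\ x0) E'.
  - by apply: leq_trans leAn; rewrite [X in (_ < X)%N](cardsD1 x0) x0A.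
  - have [->|S_neq0] := eqVneq S set0; first by rewrite cards0.
    have ltSA : S \proper A.
      rewrite properE (subset_trans sSA (subsetDl _ _)).
      by apply: contraL x0A => /subset_trans/(_ sSA)/subsetP sub; apply/negP => /sub; rewrite !inE eqxx.
    have := spare S; rewrite S_neq0 ltSA /= -ltnNge => ltSE.
    have sub : neighbors E S :\ y \subset neighbors E' S.
      apply/subsetP => z; rewrite !inE => /andP[zy /exists_inP[x xS Exz]].
      by apply/exists_inP; exists x => //; rewrite /E' Exz.
    have := subset_leq_card sub; have := cardsD1 y (neighbors E S); lia.
  exists (fun x => if x == x0 then Some y else f x) => [x xA|x1 x2 x1A x2A].
    case: eqVneq => [->|xx0]; first by exists y.
    have [|z fx /andP[Exz _]] := fE x; first by rewrite !inE xx0.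
    by exists z.
  have fy x : x \in A -> x != x0 -> f x <> Some y.
    move=> xA xx0; have [|z -> /andP[_ zy]] := fE x; first by rewrite !inE xx0.
    by case=> zy'; rewrite zy' eqxx in zy.
  case: eqVneq => [->|n1]; case: eqVneq => [->|n2] //.
  - by move/esym/fy => /(_ x2A n2).
  - by move/fy => /(_ x1A n1).
  - by apply: f_inj; rewrite !inE ?n1 ?n2.
case/existsP => S /and3P[S_neq0 ltSA tightS].
have sSA := proper_sub ltSA.
have [||f fE f_inj] := IH S E.
- by apply: leq_trans (proper_card ltSA) leAn.
- by move=> U sUS; apply: hallA; apply: subset_trans sUS sSA.
(* The neighbors of the tight part are reserved for [S]. Hall's condition survives on [A :\: S]
   because it holds for [S :|: U] and [S] has at most [#|S|] neighbors. *)
pose E' x z := E x z && (z \notin neighbors E S).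
have [|U sU|g gE g_inj] := IH (A :\: S) E'.
- apply: leq_trans leAn; rewrite -(cardsID S A) (setIidPr sSA).
  by rewrite -{1}[#|_|]add0n ltn_add2r card_gt0.
- have := hallA (S :|: U); rewrite neighborsU.
  rewrite subUset sSA (subset_trans sU (subsetDl _ _)) => /(_ isT).
  have disj : #|S :|: U| = (#|S| + #|U|)%N.
    rewrite cardsU; suff -> : S :&: U = set0 by rewrite cards0 subn0.
    apply/setP => x; rewrite !inE; apply/negP => /andP[xS xU].
    by have := subsetP sU _ xU; rewrite !inE xS.
  have sub : neighbors E S :|: neighbors E U \subset neighbors E S :|: neighbors E' U.
    apply/subsetP => z; rewrite inE => /orP[zS|zU]; rewrite inE ?zS //.
    case: (boolP (z \in neighbors E S)) => //= zS.
    move: zU; rewrite !inE => /exists_inP[x xU Exz]; apply/exists_inP.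
    by exists x => //; rewrite /E' Exz.
  have := subset_leq_card sub; rewrite disj.
  have := (leq_card_setU (neighbors E S) (neighbors E' U)).1; lia.
exists (fun x => if x \in S then f x else g x) => [x xA|x1 x2 x1A x2A].
  case: ifP => xS; first exact: fE.
  have [|z gx /andP[Exz _]] := gE x; first by rewrite inE xS.
  by exists z.
have cross x y : x \in S -> y \in A -> y \notin S -> f x <> g y.
  move=> xS yA yS; have [z -> Exz] := fE x xS.
  have [|t -> /andP[_ tS]] := gE y; first by rewrite inE yS.
  case=> zt; case/negP: tS; rewrite -zt inE; apply/exists_inP; by exists x.
case: ifPn => x1S; case: ifPn => x2S.
- exact: f_inj.
- by move/cross => /(_ x1S x2A x2S).
- by move/esym/cross => /(_ x2S x1A x1S).
- by apply: g_inj; rewrite inE ?x1S ?x2S.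
Qed.

Lemma leq_card_inj (I J : finType) (f : I -> J) (A : {set I}) (B : {set J}) :
  {in A, forall x, f x \in B} -> {in A &, injective f} -> (#|A| <= #|B|)%N.
Proof.
move=> fAB f_inj; rewrite -(card_in_imset f_inj).
by apply/subset_leq_card/subsetP => _ /imsetP[x xA ->]; apply: fAB.
Qed.

(* The entries of every row and every column are grouped by threes; a matching
   of the full column groups into the row groups gives X. *)
Lemma third_subrel (T : finType) (B : rel T) :
  exists X : rel T, [/\ subrel X B,
    forall u, (3 * #|[set v | X u v]| <= #|[set v | B u v]| + 2)%N &
    forall v, (#|[set u | B u v]| <= 3 * #|[set u | X u v]| + 2)%N].
Proof.
have div3 (a b r : nat) : (r < 3 -> a < b %/ 3 -> 3 * a + r < b)%N by lia.
pose row u := enum [set v | B u v]; pose col v := enum [set u | B u v].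
pose m := #|T|.
have rowE u v : (v \in row u) = B u v by rewrite mem_enum inE.
have colE u v : (u \in col v) = B u v by rewrite mem_enum inE.
have ri u v : B u v -> (index v (row u) < size (row u))%N by rewrite index_mem rowE.
have ci u v : B u v -> (index u (col v) < size (col v))%N by rewrite index_mem colE.
have rm u : (size (row u) <= m)%N by rewrite -cardE max_card.
have cm v : (size (col v) <= m)%N by rewrite -cardE max_card.
have ri_inj u v w : B u v -> B u w -> index v (row u) = index w (row u) -> v = w.
  by rewrite -!rowE => vu wu; apply: index_inj.
(* [p] stands for group [p.2] of column [p.1], and [q] for group [q.2] of row [q.1]; they are joined
   when they share the entry [B q.1 p.1]. *)
pose E (p q : T * 'I_m.+1) := [&& B q.1 p.1,
  index q.1 (col p.1) %/ 3 == p.2 & index p.1 (row q.1) %/ 3 == q.2]%N.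
(* Only full column groups have to be matched, so columns round down; an incomplete last row group
   may still be used, so rows round up. *)
pose A := [set p : T * 'I_m.+1 | p.2 < size (col p.1) %/ 3]%N.
have hall (S : {set T * 'I_m.+1}) : S \subset A -> (#|S| <= #|neighbors E S|)%N.
  move=> /subsetP sSA.
  (* Double counting of the entries in the column groups of [S]: each of these groups is full and
     yields three entries, and each row group absorbs at most three. *)
  pose Ar := [set p : T * T | B p.1 p.2 &
     (p.2, inord (index p.1 (col p.2) %/ 3)) \in S].
  have leSA : (#|S| * 3 <= #|Ar|)%N.
    pose f (p : T * 'I_m.+1 * 'I_3) :=
      (nth p.1.1 (col p.1.1) (3 * p.1.2 + p.2), p.1.1).
    have lt_col p r : p \in S -> (3 * p.2 + (r : 'I_3) < size (col p.1))%N.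
      by move/sSA; rewrite inE; apply: div3.
    rewrite -[3%N in leqLHS]card_ord -[#|'I_3|]cardsT -cardsX.
    apply: (@leq_card_inj _ _ f) => [[[v i] r]|[[v i] r] [[v' i'] r']].
      rewrite !inE andbT /= => viS; have /= lt := lt_col _ r viS.
      rewrite -colE mem_nth //= index_uniq ?enum_uniq //.
      rewrite (_ : inord _ = i) //; apply: val_inj; rewrite /= inordK.
        by have := ltn_ord r; lia.
      by have := cm v; lia.
    rewrite !inE !andbT /f /= => viS viS' [].
    move=> eq_nth eq_v; subst v'; have /= lt := lt_col _ r viS.
    have /= lt' := lt_col _ r' viS'.
    move/eqP: eq_nth; rewrite nth_uniq ?enum_uniq // => /eqP eq_i.
    have := ltn_ord r; have := ltn_ord r'; move=> ltr' ltr.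
    by congr (_, _, _); apply: val_inj => /=; lia.
  suff : (#|Ar| <= #|neighbors E S| * 3)%N by lia.
  rewrite -[3%N in leqRHS]card_ord -[#|'I_3|]cardsT -cardsX.
  pose f (p : T * T) : T * 'I_m.+1 * 'I_3 :=
    (p.1, inord (index p.2 (row p.1) %/ 3), inord (index p.2 (row p.1) %% 3)).
  have lt1 u v : B u v -> (index v (row u) %/ 3 < m.+1)%N.
    by move/ri; have := rm u; lia.
  apply: (@leq_card_inj _ _ f) => [[u v]|[u v] [u' v']].
    rewrite !inE andbT /= => /andP[Buv uvS]; apply/exists_inP.
    exists (v, inord (index u (col v) %/ 3)) => //; rewrite /E /= Buv.
    rewrite !inordK ?eqxx ?lt1 //.
    by have := ci _ _ Buv; have := cm v; lia.
  rewrite !inE /= => /andP[Buv _] /andP[Buv' _] [eq_u]; subst u'.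
  move/(congr1 val); rewrite /= !inordK ?lt1 // => eq_d.
  move/(congr1 val); rewrite /= !inordK ?ltn_mod // => eq_m.
  by congr (_, _); apply: (ri_inj u) => //; lia.
have [f fE f_inj] := hall_marriage hall.
pose X u v := [exists p in A, (p.1 == v) && if f p is Some q then q.1 == u else false].
have XP u v : X u v ->
    exists i j, [/\ (v, i) \in A, f (v, i) = Some (u, j) & E (v, i) (u, j)].
  case/exists_inP => -[v' i] viA /andP[/eqP/= vv']; rewrite {}vv' in viA *.
  have [[u' j] fvi Euv] := fE _ viA; rewrite fvi => /eqP/= uu'; rewrite {}uu' in fvi Euv.
  by exists i, j.
exists X; split=> [u v /XP[i [j [_ _ /and3P[]]]] //|u|v].
- pose K := ((#|[set v | B u v]| + 2) %/ 3)%N.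
  suff : (#|[set v | X u v]| <= #|[set: 'I_K]|)%N by rewrite cardsT card_ord; lia.
  have [K0|K_gt0] := posnP K.
    rewrite (_ : [set v | X u v] = set0) ?cards0 //; apply/setP => v.
    rewrite !inE; apply/negbTE/negP => /XP[i [j [_ _ /and3P[/= Buv _ _]]]].
    by have := ri _ _ Buv; rewrite /row -cardE; lia.
  have lt1 v : B u v -> (index v (row u) %/ 3 < K)%N.
    by move/ri; rewrite /row -cardE; lia.
  (* For the columns counted here [lt1] applies, so the default of [insubd] is never reached. *)
  pose g v : 'I_K := insubd (Ordinal K_gt0) (index v (row u) %/ 3)%N.
  apply: (@leq_card_inj _ _ g) => [v|v v']; rewrite !inE //.
  move=> /XP[i [j [viA fv /and3P[/= Buv _ /eqP eq_j]]]].
  move=> /XP[i' [j' [viA' fv' /and3P[/= Buv' _ /eqP eq_j']]]].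
  move/(congr1 val); rewrite !val_insubd !lt1 // eq_j eq_j' => /val_inj jj'.
  by have [] : (v, i) = (v', i') by apply: f_inj; rewrite // fv fv' jj'.
- pose K := (#|[set u | B u v]| %/ 3)%N.
  suff : (#|[set: 'I_K]| <= #|[set u | X u v]|)%N by rewrite cardsT card_ord; lia.
  have ltK (i : 'I_K) : (i < m.+1)%N.
    by have := ltn_ord i; have := cm v; rewrite /col -cardE; lia.
  have iA (i : 'I_K) : (v, Ordinal (ltK i)) \in A by rewrite inE /= /col -cardE.
  pose g (i : 'I_K) := oapp fst v (f (v, Ordinal (ltK i))).
  have gE (i : 'I_K) : exists2 j, f (v, Ordinal (ltK i)) = Some (g i, j) &
      E (v, Ordinal (ltK i)) (g i, j).
    by rewrite /g; have [[u j] -> Evu] := fE _ (iA i); exists j.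
  apply: (@leq_card_inj _ _ g) => [i _|i i' _ _ eq_g].
    rewrite inE; apply/exists_inP; exists (v, Ordinal (ltK i)) => //=.
    by have [j -> _] := gE i; rewrite !eqxx.
  have [j _ /and3P[_ /eqP/= eq_i _]] := gE i.
  have [j' _ /and3P[_ /eqP/= eq_i' _]] := gE i'.
  by apply: val_inj; rewrite /= -eq_i -eq_i' eq_g.
Qed.

(** * Row space of the inclusion matrix *)

(* The combinations of the rows of the matrix of inclusions of j-subsets of N
   into r-subsets of N. *)
Definition inclusion_span (T : finType) (N : {set T}) (r j : nat)
    (mu : {set T} -> rat) : Prop :=
  exists l : seq (rat * {set T}),
    (forall x, x \in l -> (x.2 \subset N) && (#|x.2| == r)) /\
    (forall B : {set T}, B \subset N -> #|B| = j ->
       \sum_(x <- l) x.1 * (B \subset x.2)%:R = mu B).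

Lemma inclusion_span_ext (T : finType) (N : {set T}) (r j : nat)
    (mu nu : {set T} -> rat) :
  (forall B : {set T}, B \subset N -> #|B| = j -> mu B = nu B) ->
  inclusion_span N r j mu -> inclusion_span N r j nu.
Proof. by move=> eq_mu [l [lP muE]]; exists l; split=> // B sB cB; rewrite muE ?eq_mu. Qed.

Lemma inclusion_span0 (T : finType) (N : {set T}) (r j : nat) : inclusion_span N r j (fun=> 0).
Proof. by exists [::]; split=> // B _ _; rewrite big_nil. Qed.

Lemma inclusion_spanD (T : finType) (N : {set T}) (r j : nat)
    (mu nu : {set T} -> rat) :
  inclusion_span N r j mu -> inclusion_span N r j nu ->
  inclusion_span N r j (fun B => mu B + nu B).
Proof.
move=> [l [lP muE]] [l' [lP' nuE]]; exists (l ++ l'); split=> [x|B sB cB].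
  by rewrite mem_cat => /orP[/lP|/lP'].
by rewrite big_cat /= muE ?nuE.
Qed.

Lemma inclusion_spanZ (T : finType) (N : {set T}) (r j : nat)
    (c : rat) (mu : {set T} -> rat) :
  inclusion_span N r j mu ->
  inclusion_span N r j (fun B => c * mu B).
Proof.
move=> [l [lP muE]]; exists [seq (c * x.1, x.2) | x <- l]; split=> [x|B sB cB].
  by case/mapP => y /lP yP ->.
by rewrite big_map -muE // mulr_sumr; apply: eq_bigr => x _; rewrite mulrA.
Qed.

Lemma inclusion_span_sum (T : finType) (N : {set T}) (r j : nat)
    (I : Type) (s : seq I) (P : pred I) (mu : I -> {set T} -> rat) :
  (forall i, P i -> inclusion_span N r j (mu i)) ->
  inclusion_span N r j (fun B => \sum_(i <- s | P i) mu i B).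
Proof.
move=> muP; elim: s => [|i s IHs].
  by apply: inclusion_span_ext (inclusion_span0 _ _ _) => B _ _; rewrite big_nil.
have [Pi|nPi] := boolP (P i); last first.
  by apply: inclusion_span_ext IHs => B _ _; rewrite big_cons (negPf nPi).
apply: inclusion_span_ext (inclusion_spanD (muP i Pi) IHs) => B _ _.
by rewrite big_cons Pi.
Qed.

Lemma inclusion_span_gen (T : finType) (N : {set T}) (r j : nat)
    (A : {set T}) : A \subset N -> #|A| = r ->
  inclusion_span N r j (fun B => (B \subset A)%:R).
Proof.
move=> sA cA; exists [:: (1, A)]; split=> [x|B _ _].
  by rewrite inE => /eqP->; rewrite sA cA eqxx.
by rewrite big_seq1 mul1r.
Qed.

Lemma subset_card_exists (T : finType) (N : {set T}) (k : nat) :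
  (k <= #|N|)%N -> exists2 A : {set T}, A \subset N & #|A| = k.
Proof.
move=> lek; exists [set x in take k (enum N)].
  by apply/subsetP => x; rewrite inE => /mem_take; rewrite mem_enum.
rewrite cardsE (card_uniqP _) ?take_uniq ?enum_uniq // size_take -cardE.
by case: ltnP => //; lia.
Qed.

(** Replace each set [A] of the given combination by [x |: A] minus [u |: A]. On a set [B] with both
    or neither of [x] and [u] the difference is zero; otherwise one part survives and tests [B :\ x]
    or [B :\ u] against [J]. *)
Lemma inclusion_span_exchange (T : finType) (N J : {set T}) (r j : nat) (x u : T) :
  J \subset N :\ x :\ u -> #|J| = j -> x \in N -> u \in N -> x != u ->
  inclusion_span (N :\ x :\ u) r j (fun B => (B == J)%:R) ->
  inclusion_span N r.+1 j.+1 (fun B => (B == x |: J)%:R - (B == u |: J)%:R).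
Proof.
move=> sJ cJ xN uN xu [l [lP lE]].
have NP (A : {set T}) : A \subset N :\ x :\ u -> [/\ A \subset N, x \notin A & u \notin A].
  move=> sA; split; last by apply/negP => /(subsetP sA); rewrite !inE eqxx.
    by apply: (subset_trans sA); apply: subset_trans (subsetDl _ _) (subsetDl _ _).
  by apply/negP => /(subsetP sA); rewrite !inE eqxx !andbF.
have [_ xJ uJ] := NP _ sJ.
exists ([seq (y.1, x |: y.2) | y <- l] ++ [seq (- y.1, u |: y.2) | y <- l]); split.
  move=> y; rewrite mem_cat => /orP[] /mapP[z /lP/andP[/NP[sz xz uz] /eqP cz] ->] /=;
    by rewrite cardsU1 ?xz ?uz cz add1n eqxx subUset sub1set ?xN ?uN sz.
move=> B sB cB; rewrite big_cat !big_map /= -big_split /=.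
have eqU1 (z : T) : z \notin J -> (B == z |: J) = (z \in B) && (B :\ z == J).
  move=> zJ; apply/eqP/andP => [->|[zB /eqP <-]]; last by rewrite setD1K.
  by rewrite setU11 setU1K.
rewrite !eqU1 //.
have sumE : \sum_(i <- l) (i.1 * (B \subset x |: i.2)%:R + - i.1 * (B \subset u |: i.2)%:R)
  = \sum_(i <- l) (i.1 * (B :\ x \subset i.2)%:R - i.1 * (B :\ u \subset i.2)%:R).
  by apply: eq_bigr => i _; rewrite -!subDset mulNr.
rewrite {}sumE.
have [xB|xB] := boolP (x \in B); have [uB|uB] := boolP (u \in B) => /=.
- have -> : (B :\ x == J) = false.
    by apply/eqP => eqJ; move: uJ; rewrite -eqJ !inE eq_sym xu uB.
  have -> : (B :\ u == J) = false.
    by apply/eqP => eqJ; move: xJ; rewrite -eqJ !inE xu xB.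
  rewrite subrr big_seq big1 // => i /lP/andP[/NP[_ xi ui] _].
  have -> : (B :\ x \subset i.2) = false.
    by apply: contraNF ui => /subsetP -> //; rewrite !inE eq_sym xu uB.
  have -> : (B :\ u \subset i.2) = false.
    by apply: contraNF xi => /subsetP -> //; rewrite !inE xu xB.
  by rewrite subrr.
- rewrite subr0 -lE //; last by have := cardsD1 x B; rewrite xB cB; lia.
    rewrite big_seq [RHS]big_seq; apply: eq_bigr => i /lP/andP[/NP[_ xi ui] _].
    have -> : (B :\ u \subset i.2) = false.
      by apply: contraNF xi => /subsetP -> //; rewrite !inE xu xB.
    by rewrite mulr0 subr0.
  by rewrite !subsetD1 !inE eqxx (negPf uB) !andbF (subset_trans (subsetDl _ _) sB).
- rewrite sub0r -lE //; last by have := cardsD1 u B; rewrite uB cB; lia.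
    rewrite -sumrN big_seq [RHS]big_seq; apply: eq_bigr => i /lP/andP[/NP[_ xi ui] _].
    have -> : (B :\ x \subset i.2) = false.
      by apply: contraNF ui => /subsetP -> //; rewrite !inE eq_sym xu uB.
    by rewrite mulr0 sub0r.
  by rewrite !subsetD1 !inE eqxx (negPf xB) !andbF (subset_trans (subsetDl _ _) sB).
- rewrite subrr big1 // => i _.
  have DB z : z \notin B -> B :\ z = B.
    move=> zB; apply/setP => t; rewrite !inE; case: eqVneq => //= ->.
    by rewrite (negPf zB).
  by rewrite !DB // subrr.
Qed.

(* Gottlieb: the inclusion matrix has full rank.  By [inclusion_span_exchange] all
   coordinate vectors agree modulo the row space, and a row is a sum of them. *)
Lemma inclusion_span_delta (T : finType) (k j : nat) (N J : {set T}) :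
  J \subset N -> #|J| = j -> (k + 2 * j <= #|N|)%N ->
  inclusion_span N (k + j) j (fun B => (B == J)%:R).
Proof.
elim: j N J => [|j IHj] N J sJ cJ leN.
  have [|A sA cA] := @subset_card_exists _ N k; first by lia.
  rewrite addn0; apply: inclusion_span_ext (inclusion_span_gen 0 sA cA) => B _.
  by move/cards0_eq => ->; move/cards0_eq: cJ => ->; rewrite sub0set eqxx.
have swap (J1 J2 : {set T}) : J1 \subset N -> J2 \subset N -> #|J1| = j.+1 -> #|J2| = j.+1 ->
    inclusion_span N (k + j.+1) j.+1 (fun B => (B == J1)%:R - (B == J2)%:R).
  have [n] := ubnP #|J1 :\: J2|; elim: n J1 => // n IHn J1 ltn sJ1 sJ2 cJ1 cJ2.
  have [D0|[x]] := set_0Vmem (J1 :\: J2).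
    have -> : J1 = J2.
      by apply/eqP; rewrite eqEcard -setD_eq0 D0 eqxx cJ1 cJ2 leqnn.
    by apply: inclusion_span_ext (inclusion_span0 _ _ _) => B _ _; rewrite subrr.
  rewrite inE => /andP[xJ2 xJ1].
  have [D0|[u]] := set_0Vmem (J2 :\: J1).
    suff : J2 = J1 by move=> eqJ; rewrite eqJ xJ1 in xJ2.
    by apply/eqP; rewrite eqEcard -setD_eq0 D0 eqxx cJ1 cJ2 leqnn.
  rewrite inE => /andP[uJ1 uJ2].
  have xu : x != u by apply: contraNneq uJ1 => <-.
  have cJ' : #|J1 :\ x| = j by have := cardsD1 x J1; rewrite xJ1 cJ1; lia.
  have sJ' : J1 :\ x \subset N :\ x :\ u.
    by rewrite !subsetD1 !inE eqxx (negPf uJ1) !andbF (subset_trans (subsetDl _ _) sJ1).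
  have uN := subsetP sJ2 _ uJ2; have xN := subsetP sJ1 _ xJ1.
  (* Deleting [x] and [u] costs two elements of [N] while the level drops by one; this is the source
     of the coefficient 2 in the bound. *)
  have step := inclusion_span_exchange sJ' cJ' xN uN xu (IHj _ _ sJ' cJ' _).
  have {}step : inclusion_span N (k + j.+1) j.+1
      (fun B => (B == J1)%:R - (B == u |: (J1 :\ x))%:R).
    rewrite addnS; apply: inclusion_span_ext (step _) => [B _ _|].
      by rewrite setD1K.
    have := cardsD1 x N; have := cardsD1 u (N :\ x); rewrite xN !inE eq_sym xu uN /=.
    by lia.
  have uJ' : u \notin J1 :\ x by rewrite inE (negPf uJ1) andbF.
  have rest : inclusion_span N (k + j.+1) j.+1
      (fun B => (B == u |: (J1 :\ x))%:R - (B == J2)%:R).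
    apply: IHn => //; last by rewrite cardsU1 uJ' cJ'.
      have sub : (u |: (J1 :\ x)) :\: J2 \subset (J1 :\: J2) :\ x.
        apply/subsetP => t; rewrite !inE => /andP[tJ2].
        case: eqVneq => [tu|_ /=]; first by rewrite tu uJ2 in tJ2.
        by move=> /andP[-> ->]; rewrite tJ2.
      apply: leq_ltn_trans (subset_leq_card sub) _.
      by have := cardsD1 x (J1 :\: J2); rewrite inE xJ1 xJ2 /=; lia.
    by rewrite subUset sub1set uN (subset_trans (subsetDl _ _) sJ1).
  apply: inclusion_span_ext (inclusion_spanD step rest) => B _ _.
  by rewrite addrA subrK.
have [|A sA cA] := @subset_card_exists _ N (k + j.+1); first by lia.
pose C : {set {set T}} := [set B : {set T} | B \subset A & #|B| == j.+1].
have C_gt0 : (0 < #|C|)%N by rewrite cards_draws cA bin_gt0 leq_addl.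
(* The row of [A] is the sum of the coordinate vectors of all [D] in [C]. Adding these differences
   turns it into [#|C|] times the coordinate vector of [J]. *)
have diff : inclusion_span N (k + j.+1) j.+1
    (fun B => \sum_(D in C) ((B == J)%:R - (B == D)%:R)).
  apply: inclusion_span_sum => D; rewrite inE => /andP[sD /eqP cD].
  by apply: swap => //; apply: subset_trans sD sA.
apply: inclusion_span_ext (inclusion_spanZ #|C|%:R^-1
  (inclusion_spanD (inclusion_span_gen j.+1 sA cA) diff)) => B sB cB.
rewrite sumrB sumr_const.
have -> : \sum_(D in C) (B == D)%:R = (B \subset A)%:R :> rat.
  have [BC|BC] := boolP (B \in C).
    rewrite (bigD1 B) //= eqxx big1 => [|D /andP[_ /negPf DB]]; last by rewrite eq_sym DB.
    by move: BC; rewrite inE cB eqxx andbT => ->; rewrite addr0.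
  rewrite big1 => [|D DC]; last by case: eqVneq => // BD; rewrite BD DC in BC.
  by move: BC; rewrite inE cB eqxx andbT => /negPf ->.
by rewrite addrC subrK -[(B == J)%:R *+ _]mulr_natl mulKf // pnatr_eq0 -lt0n.
Qed.

(** * The functional Phi, through Euler operators and augmentations *)

Lemma sum_count_mem (T : eqType) (vs s : seq T) :
  uniq vs -> {subset s <= vs} -> (\sum_(w <- vs) count_mem w s = size s)%N.
Proof.
move=> vs_uniq; elim: s => [|u s IHs] svs /=; first by rewrite big1.
rewrite big_split /= IHs => [|w ws]; last by apply: svs; rewrite inE ws orbT.
rewrite (bigD1_seq u) ?svs ?mem_head //= eqxx big1 ?addn0 // => w.
by rewrite eq_sym => /negPf->.
Qed.

(* [Phi] sees the products of [size s] augmentations [eps w], [w \in s], as a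
   polynomial of degree [\sum_w k w] whose leading part is a multiple of the
   monomial with exponents [k]. *)
Definition leading_monomial (T : finType) (R : comNzRingType) (eps : T -> R)
    (Phi : R -> rat) (vs : seq T) (k : T -> nat) : Prop :=
  exists2 c : rat, c != 0 &
    forall s : seq T, {subset s <= vs} -> (\sum_(w <- vs) k w <= size s)%N ->
      Phi (\prod_(w <- s) eps w)
        = if all (fun w => count_mem w s == k w) vs then c else 0.

Section EulerFunctional.
Variable T : finType.
Local Notation P := {mpoly rat[#|T|]}.

Definition vertex_var (w : T) : P := 'X_(enum_rank w).

Definition euler (w : T) (p : P) : P := vertex_var w * p^`M(enum_rank w).

(** Monomials are common eigenvectors of the operators [euler w], the eigenvalue being the exponent
    of [w]. Composing the operators [euler w - c] and evaluating at the all-ones point therefore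
    multiplies the numbers [t w - c]. *)
Fixpoint euler_functional (L : seq (T * rat)) (p : P) : rat :=
  if L is (w, c) :: L' then euler_functional L' (euler w p - c *: p)
  else p.@[fun=> 1].

Lemma euler_functionalB L : {morph euler_functional L : p q / p - q}.
Proof.
elim: L => [|[w c] L IHL] p q /=; first by rewrite mevalB.
rewrite -IHL; congr euler_functional.
by rewrite /euler mderivB mulrBr scalerBr; ring.
Qed.

Lemma euler_functionalD L : {morph euler_functional L : p q / p + q}.
Proof.
move=> p q; have F0 : euler_functional L 0 = 0 by rewrite -(subrr 0) euler_functionalB subrr.
have FN r : euler_functional L (- r) = - euler_functional L r.
  by rewrite -[- r]sub0r euler_functionalB F0 sub0r.
by rewrite -{1}(opprK q) euler_functionalB FN opprK.
Qed.

Lemma eulerM w p q : euler w (p * q) = euler w p * q + p * euler w q.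
Proof. by rewrite /euler mderivM; ring. Qed.

Lemma euler_var w u : euler w (vertex_var u) = if u == w then vertex_var w else 0.
Proof.
rewrite /euler /vertex_var mderivX mnm1E.
have [->|uw] := eqVneq u w; last by rewrite (inj_eq enum_rank_inj) (negPf uw) scale0r mulr0.
by rewrite eqxx scale1r -mpolyXD addmC submK // lep1mP mnm1E eqxx.
Qed.

Lemma euler1 w : euler w 1 = 0.
Proof. by rewrite /euler -mpolyC1 mderivC mulr0. Qed.

Lemma euler_augmentation w s :
  euler w (\prod_(u <- s) (vertex_var u - 1))
    = (count_mem w s)%:R * \prod_(u <- rem w s) (vertex_var u - 1) * vertex_var w.
Proof.
elim: s => [|u s IHs]; first by rewrite big_nil euler1 /= !mul0r.
have -> : euler w (\prod_(v <- u :: s) (vertex_var v - 1))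
    = euler w (vertex_var u) * \prod_(v <- s) (vertex_var v - 1)
      + (vertex_var u - 1) * euler w (\prod_(v <- s) (vertex_var v - 1)).
  by rewrite big_cons eulerM {1}/euler mderivB mulrBr -/(euler w _) -/(euler w _) euler1 subr0.
rewrite IHs euler_var /=; case: eqVneq => [->|uw]; last first.
  by rewrite add0n big_cons; ring.
case: (boolP (w \in s)) => [ws|/count_memPn->]; last by rewrite addn0 mulr0n /=; ring.
rewrite (perm_big _ (perm_to_rem ws)) big_cons natrD /=; ring.
Qed.

(** Each operator lowers the order of vanishing at the all-ones point by at most one, so with fewer
    operators than factors a zero remains there. *)
Lemma euler_functional_vanish L s r : (size L < size s)%N ->
  euler_functional L (\prod_(u <- s) (vertex_var u - 1) * r) = 0.
Proof.
elim: L s r => [|[w c] L IHL] s r /=.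
  case: s => // u s _; rewrite big_cons -mulrA rmorphM rmorphB rmorph1 /= mevalXU.
  by rewrite subrr mul0r.
move=> ltLs; rewrite eulerM -addrA scalerAr -mulrBr euler_functionalD.
rewrite [X in _ + X]IHL ?addr0 ?(ltnW ltLs) // euler_augmentation.
case: (boolP (w \in s)) => [ws|/count_memPn->]; last first.
  by rewrite !mul0r -[X in euler_functional _ X](subrr 0) euler_functionalB subrr.
by rewrite [_%:R * _]mulrC -!mulrA IHL // size_rem //; case: (s) ltLs.
Qed.

(** With as many operators as factors, only terms in which every operator differentiates an
    augmentation survive, so the variables must match as multisets. The constant is the product of
    the factorials of the multiplicities in [L]. *)
Lemma euler_functional_lead L : exists2 c : rat, c != 0 &
  forall s r, size s = size L ->
    euler_functional L (\prod_(u <- s) (vertex_var u - 1) * r)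
      = if perm_eq s (unzip1 L) then c * r.@[fun=> 1] else 0.
Proof.
elim: L => [|[w d] L [c c_neq0 IHL]] /=.
  by exists 1 => // s r /size0nil->; rewrite big_nil mul1r perm_refl mul1r.
exists ((count_mem w (unzip1 L)).+1%:R * c); first by rewrite mulf_neq0 ?pnatr_eq0.
move=> s r szs; rewrite eulerM -addrA scalerAr -mulrBr euler_functionalD.
rewrite [X in _ + X]euler_functional_vanish ?addr0 ?szs // euler_augmentation.
case: (boolP (w \in s)) => [ws|wNs]; last first.
  rewrite (count_memPn wNs) !mul0r -[X in euler_functional _ X](subrr 0).
  rewrite euler_functionalB subrr; case: ifP => // /perm_mem/(_ w).
  by rewrite inE eqxx (negPf wNs).
rewrite [_%:R * _]mulrC -!mulrA IHL ?size_rem ?szs //.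
have -> : perm_eq s (w :: unzip1 L) = perm_eq (rem w s) (unzip1 L).
  by rewrite (permPl (perm_to_rem ws)) perm_cons.
case: ifP => // peq; rewrite !rmorphM rmorph_nat /= mevalXU mul1r.
have /permP/(_ (pred1 w)) -> : perm_eq s (w :: unzip1 L).
  by rewrite (permPl (perm_to_rem ws)) perm_cons.
by rewrite /= eqxx add1n; ring.
Qed.

Lemma euler_monomial w (t : T -> nat) :
  euler w (\prod_u vertex_var u ^+ t u) = (t w)%:R *: \prod_u vertex_var u ^+ t u.
Proof.
have -> : \prod_u vertex_var u ^+ t u = 'X_[[multinom t (enum_val i) | i < #|T|]] :> P.
  rewrite mpolyXE_id (reindex (@enum_rank T)) /=; last first.
    by apply: onW_bij; exact: enum_rank_bij.
  by apply: eq_bigr => u _; rewrite mnmE enum_rankK.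
rewrite /euler mderivX mnmE enum_rankK -scalerAr.
have [->|t_neq0] := eqVneq (t w) 0%N; first by rewrite !scale0r.
by rewrite -mpolyXD addmC submK // lep1mP mnmE enum_rankK.
Qed.

Lemma euler_functional_monomial L (t : T -> nat) :
  euler_functional L (\prod_u vertex_var u ^+ t u)
    = \prod_(x <- L) ((t x.1)%:R - x.2).
Proof.
elim: L => [|[w c] L IHL] /=.
  rewrite big_nil rmorph_prod big1 // => u _.
  by rewrite rmorphXn /= mevalXU expr1n.
rewrite big_cons -IHL euler_monomial -scalerBl /=.
elim: L {IHL} (_ - _) (\prod_u _) => [|[u d] L IHL] a p /=; first by rewrite mevalZ.
by rewrite -IHL; congr euler_functional;
  rewrite /euler mderivZ -scalerAr scalerBr !scalerA [d * a]mulrC.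
Qed.

Lemma euler_functional_leading_monomial (vs : seq T) (F : T -> seq rat) :
  uniq vs ->
  leading_monomial (fun w => vertex_var w - 1)
    (euler_functional [seq (w, c) | w <- vs, c <- F w]) vs (fun w => size (F w)).
Proof.
move=> vs_uniq; set L := [seq _ | _ <- _, _ <- _].
have szL : size L = \sum_(w <- vs) size (F w).
  by rewrite size_allpairs_dep sumnE big_map.
have [c c_neq0 leadE] := euler_functional_lead L; exists c => // s svs.
rewrite -szL leq_eqVlt => /predU1P[szs|lts].
  rewrite -[\prod_(_ <- _) _]mulr1 leadE // meval1 mulr1.
  congr (if _ then _ else _).
  have countL w : w \in vs -> count_mem w (unzip1 L) = size (F w).
    rewrite /L; elim: (vs) vs_uniq => //= u us IHus /andP[uus us_uniq].
    rewrite inE /unzip1 map_cat count_cat -map_comp.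
    have cst : count_mem w [seq (fst \o pair u) i | i <- F u] = ((u == w) * size (F u))%N.
      elim: (F u) => [|x l IHl] /=; first by rewrite muln0.
      by rewrite IHl; case: eqP => //=; rewrite ?mul0n ?mul1n.
    rewrite cst; case: (eqVneq w u) => [-> _|wu /=].
      rewrite mul1n; apply/eqP; rewrite -{2}[size _]addn0 eqn_add2l -leqn0 leqNgt.
      rewrite -has_count; apply: contra uus => /hasP[x /mapP[[a b]]].
      by case/allpairsPdep => [a' [b' [a'us _ [-> ->]]]] -> /eqP <-.
    by move=> wus; rewrite mul0n add0n IHus.
  apply/idP/idP => [/permP peq|/allP eqc].
    by apply/allP => w wvs; rewrite peq countL.
  apply/allP => w; rewrite mem_cat => wsL; have wvs : w \in vs.
    case/orP: wsL => [/svs //|/mapP[[a b]]].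
    by case/allpairsPdep => [a' [b' [a'vs _ [-> ->]]]] ->.
  by rewrite /= countL // -(eqP (eqc w wvs)) /= eqxx.
(* In a product longer than [L] the multiplicities cannot all agree, as they would add up to
   [size L]; both sides are zero. *)
rewrite -[\prod_(_ <- _) _]mulr1 euler_functional_vanish //.
case: ifP => // /allP eqc; move: lts; rewrite szL.
have := sum_count_mem vs_uniq svs.
by rewrite (eq_big_seq (fun w => size (F w))) => [->|w /eqc/eqP //]; rewrite ltnn.
Qed.
End EulerFunctional.

(** * Eliminating a vertex *)

Lemma prodrB_powerset (T : finType) (R : comNzRingType) (A : {set T}) (a : R) (b : T -> R) :
  \prod_(w in A) (a - b w)
    = \sum_(B in powerset A) (-1) ^+ #|B| * (a ^+ (#|A| - #|B|) * \prod_(w in B) b w).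
Proof.
pose F w := if w \in A then - b w else 0; pose G w := if w \in A then a else 1.
have -> : \prod_(w in A) (a - b w) = \prod_w (F w + G w).
  rewrite big_mkcond; apply: eq_bigr => w _; rewrite /F /G.
  by case: ifP => _; rewrite ?add0r // addrC.
rewrite bigA_distr (bigID (mem (powerset A))) /= addrC big1 ?add0r => [|B].
  apply: eq_bigr => B; rewrite powersetE => sBA; rewrite (bigID (mem B)) /=.
  have -> : \prod_(w in B) (if w \in B then F w else G w) = \prod_(w in B) - b w.
    by apply: eq_bigr => w wB; rewrite wB /F (subsetP sBA).
  have -> : \prod_(w | w \notin B) (if w \in B then F w else G w)
      = \prod_(w in A :\: B) a.
    rewrite (eq_bigr G) => [|w /negPf-> //]; rewrite /G -big_mkcondr.
    by apply: eq_bigl => w; rewrite inE.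
  by rewrite prodrN prodr_const cardsDS // mulrAC mulrA.
rewrite powersetE => /subsetPn[w wB wA].
by rewrite (bigD1 w) //= wB /F (negPf wA) mul0r.
Qed.

Section Elimination.
Variables (T : finType) (e : rel T) (R : comNzRingType) (E : T -> R).
Local Notation eps := (fun w => E w - 1).
Implicit Types (Phi : R -> rat) (vs s : seq T) (k : T -> nat).

(** Expanding the factors [E v - E w] picks a direction for each edge from [v] to [x.2], and the
    power of [E v] directs the other edges between [v] and [N] out of [v]. Every monomial thus comes
    from an orientation of all these edges. *)
Definition eliminated Phi (v : T) (N : {set T}) (l : seq (rat * {set T})) (p : R) : rat :=
  \sum_(x <- l) x.1 * Phi (\prod_(w in x.2) (E v - E w) * (E v ^+ (#|N| - #|x.2|) * p)).

Lemma additive_sign Phi n p :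
  {morph Phi : p q / p + q} -> Phi ((-1) ^+ n * p) = (-1) ^+ n * Phi p.
Proof.
move=> PhiD; have Phi0 : Phi 0 = 0 by apply: (addrI (Phi 0)); rewrite -PhiD !addr0.
have PhiN q : Phi (- q) = - Phi q by apply: (addrI (Phi q)); rewrite -PhiD !subrr.
by elim: n p => [|n IHn] p; rewrite ?mul1r // !exprS -!mulrA !mulN1r PhiN IHn.
Qed.

(** Write [E v] as 1 plus its augmentation: every further augmentation makes the product longer than
    the total exponent, and [Phi] vanishes there. *)
Lemma leading_monomial_shift Phi vs k v m s :
  uniq vs -> {morph Phi : p q / p + q} -> leading_monomial eps Phi vs k ->
  v \in vs -> {subset s <= vs} -> (\sum_(w <- vs) k w <= size s)%N ->
  Phi (E v ^+ m * \prod_(w <- s) (E w - 1)) = Phi (\prod_(w <- s) (E w - 1)).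
Proof.
move=> vs_uniq PhiD [c c_neq0 PhiE] vvs.
elim: m s => [|m IHm] s svs les; first by rewrite mul1r.
have svs' : {subset v :: s <= vs} by move=> w; rewrite inE => /predU1P[->|/svs].
have -> : E v ^+ m.+1 * \prod_(w <- s) (E w - 1)
    = E v ^+ m * \prod_(w <- s) (E w - 1) + E v ^+ m * \prod_(w <- v :: s) (E w - 1).
  by rewrite exprSr big_cons; ring.
rewrite PhiD IHm // IHm //=; last exact: leqW.
rewrite [X in _ + X]PhiE //=; last exact: leqW.
case: ifP; rewrite ?addr0 // => /allP eqk.
have := sum_count_mem vs_uniq svs'.
rewrite (eq_big_seq k) => [/= szE|w /eqk/eqP //].
by move: les; rewrite szE ltnn.
Qed.

(** Write [E v - E w] as a difference of augmentations and expand. Taking the augmentation of [w]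
    exactly for [w] in [B] gives [E v - 1] the exponent [k v] only if [#|B| = #|J|], and [l] is such
    that the coefficients of all these [B] except [J] sum to zero. *)
Lemma eliminated_leading Phi v vs k (N J : {set T})
    (l : seq (rat * {set T})) :
  uniq (v :: vs) -> {morph Phi : p q / p + q} ->
  leading_monomial eps Phi (v :: vs) k ->
  {subset N <= vs} -> J \subset N -> (forall w, w \in J -> 0 < k w)%N ->
  (forall x, x \in l -> (x.2 \subset N) && (#|x.2| == k v + #|J|)%N) ->
  (forall B : {set T}, B \subset N -> #|B| = #|J| ->
     \sum_(x <- l) x.1 * (B \subset x.2)%:R = (B == J)%:R) ->
  leading_monomial eps (eliminated Phi v N l) vs (fun w => k w - (w \in J))%N.
Proof.
move=> vvs_uniq PhiD PhiL sNvs sJN k_gt0 lP lE.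
have /andP[vNvs vs_uniq] := vvs_uniq.
have Phi0 : Phi 0 = 0 by apply: (addrI (Phi 0)); rewrite -PhiD !addr0.
have Phi_sign n p := additive_sign n p PhiD.
have Phi_sum (I : Type) (r : seq I) (Q : pred I) F :
    Phi (\sum_(i <- r | Q i) F i) = \sum_(i <- r | Q i) Phi (F i).
  by apply: (big_morph Phi PhiD Phi0).
have sumJ : (\sum_(w <- vs) (w \in J) = #|J|)%N.
  rewrite big_uniq //= -sum1_card big_mkcond [RHS]big_mkcond /=.
  apply: eq_bigr => w _; case: (boolP (w \in J)) => [wJ|]; last by case: ifP.
  by rewrite sNvs // (subsetP sJN).
have sumk : (\sum_(w <- vs) k w = \sum_(w <- vs) (k w - (w \in J)) + #|J|)%N.
  rewrite -sumJ -big_split; apply: eq_bigr => w _ /=.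
  by case: (boolP (w \in J)) => [/k_gt0|]; lia.
have PhiS := leading_monomial_shift _ vvs_uniq PhiD PhiL (mem_head v vs).
case: PhiL => c c_neq0 PhiE.
exists ((-1) ^+ #|J| * c); first by rewrite mulf_neq0 ?signr_eq0.
move=> s svs les; pose matching (B : {set T}) :=
  all (fun w => (w \in B) + count_mem w s == k w)%N vs.
(* [PhiS] removes the power of [E v]; what remains is the product of the augmentations listed in
   [t], which [PhiE] evaluates. *)
have termE (A B : {set T}) : A \subset N -> #|A| = (k v + #|J|)%N -> B \subset A ->
    (-1) ^+ #|B| * Phi ((E v - 1) ^+ (#|A| - #|B|) * (\prod_(w in B) (E w - 1) *
      (E v ^+ (#|N| - #|A|) * \prod_(w <- s) (E w - 1))))
    = if (#|B| == #|J|) && matching B then (-1) ^+ #|J| * c else 0.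
  move=> sAN cA sBA; pose t := nseq (#|A| - #|B|) v ++ enum B ++ s.
  have sBvs w : w \in B -> w \in vs by move=> wB; apply/sNvs/(subsetP sAN)/(subsetP sBA).
  have svs' : {subset t <= v :: vs}.
    move=> w; rewrite !mem_cat mem_nseq mem_enum inE.
    by case/or3P=> [/andP[_ ->] //|/sBvs->|/svs->]; rewrite orbT.
  have szt : size t = (k v + #|J| + size s)%N.
    rewrite !size_cat size_nseq -cardE; have := subset_leq_card sBA; lia.
  have -> : (E v - 1) ^+ (#|A| - #|B|) * (\prod_(w in B) (E w - 1) *
      (E v ^+ (#|N| - #|A|) * \prod_(w <- s) (E w - 1)))
      = E v ^+ (#|N| - #|A|) * \prod_(w <- t) (E w - 1).
    by rewrite !big_cat big_nseq -big_enum /= iter_mulr_1; ring.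
  have let_ : (\sum_(w <- v :: vs) k w <= size t)%N by rewrite big_cons sumk szt; lia.
  rewrite PhiS // PhiE //=.
  have vB : (v \in B) = false by apply: contraNF vNvs => /sBvs.
  have vs0 : count_mem v s = 0%N by apply/count_memPn; apply: contra vNvs => /svs.
  have cntv : count_mem v t = (#|A| - #|B|)%N.
    rewrite !count_cat count_nseq /= eqxx mul1n vs0 count_uniq_mem ?enum_uniq //.
    by rewrite mem_enum vB !addn0.
  have cntw : all (fun w => count_mem w t == k w) vs = matching B.
    apply: eq_in_all => w wvs; congr (_ == _).
    rewrite !count_cat count_nseq /= count_uniq_mem ?enum_uniq // mem_enum.
    by case: eqVneq => [vw|_]; rewrite ?mul0n //; rewrite vw wvs in vNvs.
  rewrite cntv cntw.
  have -> : (#|A| - #|B| == k v)%N = (#|B| == #|J|).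
    by have := subset_leq_card sBA; rewrite cA; lia.
  case: eqP => [->|_] /=; last by rewrite mulr0.
  by case: (matching B); rewrite ?mulr0.
have -> : eliminated Phi v N l (\prod_(w <- s) (E w - 1)) =
    \sum_(x <- l) \sum_(B : {set T} | (B \subset N) && (#|B| == #|J|))
      x.1 * (B \subset x.2)%:R * (if matching B then (-1) ^+ #|J| * c else 0).
  rewrite /eliminated big_seq [RHS]big_seq; apply: eq_bigr => -[a A] /lP/= /andP[sAN /eqP cA].
  have -> : \prod_(w in A) (E v - E w) = \prod_(w in A) ((E v - 1) - (E w - 1)).
    by apply: eq_bigr => w _; ring.
  rewrite prodrB_powerset mulr_suml Phi_sum mulr_sumr.
  rewrite [RHS](bigID (fun B : {set T} => B \subset A)) /= [X in _ = _ + X]big1 ?addr0; last first.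
    by move=> B /andP[_ /negPf->]; rewrite mulr0 mul0r.
  rewrite (eq_bigl (fun B : {set T} => B \subset A)) => [|B]; last exact: powersetE.
  under eq_bigr => B sBA do rewrite -!mulrA Phi_sign termE //.
  rewrite (bigID (fun B : {set T} => #|B| == #|J|)) /= addrC big1 ?add0r; last first.
    by move=> B /andP[_ /negPf->]; rewrite mulr0.
  apply: eq_big => [B|B /andP[-> ->]]; last by rewrite mulr1.
  case: (boolP (B \subset A)) => [sBA|]; last by rewrite andbF.
  by rewrite (subset_trans sBA sAN) andbT.
rewrite exchange_big /= (bigD1 J) /=; last by rewrite sJN eqxx.
rewrite -mulr_suml lE // eqxx mul1r big1 ?addr0 => [|B]; last first.
  by case/andP => /andP[sB /eqP cB] BJ; rewrite -mulr_suml lE // (negPf BJ) mul0r.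
congr (if _ then _ else _); apply: eq_in_all => w _.
case: (boolP (w \in J)) => [/k_gt0|_] /=; first by lia.
by rewrite add0n subn0.
Qed.

(** If [Phi] killed every monomial of the expansion, the combination would be zero. [B] is the set
    of neighbors whose edge is directed toward [v]. *)
Lemma eliminated_neq0 Phi v (N : {set T}) (l : seq (rat * {set T})) (p : R) :
  {morph Phi : p q / p + q} ->
  (forall x, x \in l -> x.2 \subset N) -> eliminated Phi v N l p != 0 ->
  exists2 B : {set T}, B \subset N &
    Phi (E v ^+ (#|N| - #|B|) * \prod_(w in B) E w * p) != 0.
Proof.
move=> PhiD lN nz.
have Phi0 : Phi 0 = 0 by apply: (addrI (Phi 0)); rewrite -PhiD !addr0.
suff /exists_inP[B sB nzB] : [exists B in powerset N,
    Phi (E v ^+ (#|N| - #|B|) * \prod_(w in B) E w * p) != 0].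
  by exists B; rewrite -?powersetE.
apply: contraNT nz => /exists_inPn vanish; apply/eqP.
rewrite /eliminated big1_seq // => -[a A] /andP[_ /lN /= sA].
rewrite prodrB_powerset mulr_suml (big_morph Phi PhiD Phi0) big1 ?mulr0 // => B.
rewrite powersetE => sBA; have sBN := subset_trans sBA sA.
have := vanish B; rewrite powersetE => /(_ sBN); rewrite negbK => /eqP PhiB0.
have := subset_leq_card sBA; have := subset_leq_card sA => leAN leBA.
have -> : (-1) ^+ #|B| * (E v ^+ (#|A| - #|B|) * \prod_(w in B) E w)
     * (E v ^+ (#|N| - #|A|) * p)
    = (-1) ^+ #|B| * (E v ^+ (#|N| - #|B|) * \prod_(w in B) E w * p).
  have -> : (#|N| - #|B| = (#|A| - #|B|) + (#|N| - #|A|))%N by lia.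
  by rewrite exprD; ring.
by rewrite (additive_sign _ _ PhiD) PhiB0 mulr0.
Qed.

(* [gifts v] is the set of remaining neighbors whose degree drops by one when
   [v] is eliminated. *)
Lemma elimination Phi vs k (gifts : T -> {set T}) :
  symmetric e -> irreflexive e -> uniq vs -> {morph Phi : p q / p + q} ->
  leading_monomial eps Phi vs k ->
  (forall pre v suf, vs = pre ++ v :: suf ->
     gifts v \subset [set w in suf | e v w] /\
     (k v - count (fun x => v \in gifts x) pre + 2 * #|gifts v|
       <= #|[set w in suf | e v w]|)%N) ->
  exists D : rel T, [/\ forall u w, D u w -> [&& u \in vs, w \in vs & e u w],
    {in vs &, forall u w, e u w -> D u w (+) D w u} &
    Phi (\prod_w E w ^+ #|[set u | D w u]|) != 0].
Proof.
move=> e_sym e_irr; elim: vs Phi k => [|v vs IHvs] Phi k vs_uniq PhiD PhiL giftsP.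
  exists (fun _ _ => false); split=> //; case: PhiL => c c_neq0 /(_ [::]).
  rewrite !big_nil /= => PhiE; rewrite big1 ?PhiE // => w _.
  by rewrite (_ : [set _ | _] = set0) ?cards0 //; apply/setP => u; rewrite !inE.
have /andP[vNvs uniq_vs] := vs_uniq.
(* An exponent that is already zero cannot drop, so a gift to such a vertex is discarded; this
   agrees with the truncated subtraction in [giftsP]. *)
pose N := [set w in vs | e v w]; pose J := [set w in gifts v | 0 < k w]%N.
have [sGN leN] := giftsP [::] v vs erefl; rewrite /= subn0 -/N in sGN leN.
have sJG : J \subset gifts v by apply/subsetP => w; rewrite inE => /andP[].
have sJN := subset_trans sJG sGN; have leJG := subset_leq_card sJG.
have k_gt0 w : w \in J -> (0 < k w)%N by rewrite inE => /andP[].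
have sNvs : {subset N <= vs} by move=> w; rewrite inE => /andP[].
have [|l [lP lE]] := @inclusion_span_delta _ (k v) _ N J sJN erefl; first by lia.
have PhiL' := eliminated_leading vs_uniq PhiD PhiL sNvs sJN k_gt0 lP lE.
have PhiD' : {morph eliminated Phi v N l : p q / p + q}.
  by move=> p q; rewrite -big_split; apply: eq_bigr => x _; rewrite !mulrDr PhiD mulrDr.
have [|D [DP Dor nz]] := IHvs _ _ uniq_vs PhiD' PhiL'.
  move=> pre u suf eq_vs; have := giftsP (v :: pre) u suf; rewrite eq_vs => /(_ erefl)[-> /=].
  rewrite inE => le1; split=> //; apply: leq_trans le1; rewrite leq_add2r.
  by case: (u \in gifts v) => /=; case: (k u); lia.
have lN x : x \in l -> x.2 \subset N by case/lP/andP.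
have [B sBN nzB] := eliminated_neq0 PhiD lN nz.
have Bvs w : w \in B -> w \in vs by move/(subsetP sBN)/sNvs.
have vB : v \notin B by apply: contra vNvs => /Bvs.
have vN : v \notin N by apply: contra vNvs => /sNvs.
(* The edges at [v] are read off the surviving monomial: [B] points to [v], and [v] points to the
   rest of [N]. *)
pose D' u w := if u == v then w \in N :\: B else if w == v then u \in B else D u w.
have Dv u : D v u = false by apply/negP => /DP; rewrite (negPf vNvs).
have Dv' u : D u v = false by apply/negP => /DP; rewrite (negPf vNvs) andbF.
exists D'; split=> [u w|u w|].
- rewrite /D' !inE; case: eqVneq => [->|uv].
    by case/andP => _ /andP[-> ->]; rewrite orbT.
  case: eqVneq => [-> uB|wv /DP/and3P[-> -> ->] //].
  by rewrite (Bvs _ uB) e_sym; have := subsetP sBN _ uB; rewrite inE => /andP[_ ->].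
- rewrite /D' !inE; case: (eqVneq u v) => [->|uv]; case: (eqVneq w v) => [->|wv] /=.
  + by rewrite e_irr.
  + by move=> _ wvs evw; rewrite wvs evw andbT; case: (w \in B).
  + by move=> uvs _; rewrite e_sym => evu; rewrite uvs evu andbT; case: (u \in B).
  + by move=> uvs wvs; apply: Dor.
suff -> : \prod_w E w ^+ #|[set u | D' w u]| = E v ^+ (#|N| - #|B|) *
    \prod_(w in B) E w * \prod_w E w ^+ #|[set u | D w u]| by [].
have outE w : #|[set u | D' w u]| =
    ((w == v) * (#|N| - #|B|) + (w \in B) + #|[set u | D w u]|)%N.
  case: (eqVneq w v) => [->|wv].
    rewrite (negPf vB) (_ : [set u | D v u] = set0); last first.
      by apply/setP => u; rewrite !inE Dv.
    rewrite cards0 mul1n !addn0 -cardsDS //; apply: eq_card => u.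
    by rewrite !inE /D' eqxx !inE.
  case: (boolP (w \in B)) => wB.
    rewrite (_ : [set u | D' w u] = v |: [set u | D w u]) ?cardsU1 ?inE ?Dv' //.
    by apply/setP => u; rewrite !inE /D' (negPf wv); case: eqVneq => // ->.
  apply: eq_card => u; rewrite !inE /D' (negPf wv).
  by case: eqVneq => // ->; rewrite (negPf wB) Dv'.
under eq_bigr => w _ do rewrite outE !exprD.
rewrite !big_split /=; congr (_ * _ * _).
  by rewrite (bigD1 v) //= eqxx mul1n big1 ?mulr1 // => w /negPf->; rewrite mul0n.
by rewrite [RHS]big_mkcond; apply: eq_bigr => w _; case: (w \in B).
Qed.
End Elimination.

(** * Elimination order, gift counting and the final assembly *)

(** Within any vertex set the indegrees and the outdegrees have the same sum, so in some vertex the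
    indegree is at most the outdegree. It goes first, and induction orders the rest. *)
Lemma elimination_order (T : finType) (D : rel T) :
  exists vs : seq T, [/\ uniq vs, forall x, x \in vs &
    forall pre v suf, vs = pre ++ v :: suf ->
      (#|[set u in suf | D u v]| <= #|[set u in suf | D v u]|)%N].
Proof.
suff /(_ [set: T])[vs [vs_uniq vsE vsP]] : forall S : {set T},
    exists vs : seq T, [/\ uniq vs, vs =i S &
    forall pre v suf, vs = pre ++ v :: suf ->
      (#|[set u in suf | D u v]| <= #|[set u in suf | D v u]|)%N].
  by exists vs; split=> // x; rewrite vsE inE.
move=> S; have [n] := ubnP #|S|; elim: n S => // n IHn S; rewrite ltnS => leSn.
have [->|[x0 x0S]] := set_0Vmem S.
  by exists [::]; split=> [//|x|[|? ?] ? ? //]; rewrite inE.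
have /exists_inP[v vS le_v] : [exists v in S,
    #|[set u in S | D u v]| <= #|[set u in S | D v u]|]%N.
  apply: contraT => /exists_inPn gt_in.
  have : (\sum_(v in S) #|[set u in S | D v u]| < \sum_(v in S) #|[set u in S | D u v]|)%N.
    rewrite (bigD1 x0) //= [X in (_ < X)%N](bigD1 x0) //=.
    have := gt_in x0 x0S; rewrite -ltnNge => lt0; apply: leq_add lt0 _.
    by apply: leq_sum => v /andP[vS _]; have := gt_in v vS; rewrite -ltnNge => /ltnW.
  have cardE (p : pred T) : #|[set u in S | p u]| = (\sum_(u in S) p u)%N.
    by rewrite -sum1_card -big_mkcondr; apply: eq_bigl => u; rewrite inE.
  under eq_bigr do rewrite cardE; rewrite exchange_big /=.
  by under [X in (_ < X)%N]eq_bigr do rewrite cardE; rewrite ltnn.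
have [|vs [vs_uniq vsE vsP]] := IHn (S :\ v).
  by apply: leq_trans leSn; rewrite [X in (_ < X)%N](cardsD1 v) vS.
exists (v :: vs); split=> [|x|[|y pre] w suf].
- by rewrite /= vs_uniq vsE !inE eqxx.
- by rewrite inE vsE !inE; case: eqVneq => // ->.
- case=> <- <-.
  have cardE (p : pred T) : #|[set u in S | p u]| = (p v + #|[set u in vs | p u]|)%N.
    rewrite (cardsD1 v) !inE vS; congr (_ + _)%N; apply: eq_card => u.
    by rewrite !inE vsE !inE andbA.
  by move: le_v; rewrite !cardE leq_add2l.
- by case=> _; apply: vsP.
Qed.

Lemma index_split (T : eqType) (pre suf : seq T) (v : T) :
  uniq (pre ++ v :: suf) ->
  (forall x, (index x (pre ++ v :: suf) < index v (pre ++ v :: suf))%N = (x \in pre)) /\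
  (forall x, x \in pre ++ v :: suf ->
     (index v (pre ++ v :: suf) < index x (pre ++ v :: suf))%N = (x \in suf)).
Proof.
rewrite cat_uniq /= => /and3P[pre_uniq /norP[vpre disj] /andP[vsuf suf_uniq]].
have idxv : index v (pre ++ v :: suf) = size pre.
  by rewrite index_cat (negPf vpre) /= eqxx addn0.
rewrite idxv; split=> [x|x xvs]; rewrite index_cat; case: (boolP (x \in pre)) => xpre.
- by rewrite index_mem.
- by rewrite ltnNge leq_addr.
- rewrite ltnNge ltnW ?index_mem //=; apply/esym/negP => xsuf.
  by case/hasP: disj; exists x.
- move: xvs; rewrite mem_cat (negPf xpre) /= inE.
  case: eqVneq => [-> _|xv /= ->]; last by rewrite addnS ltnS leq_addr.
  by rewrite addn0 ltnn (negPf vsuf).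
Qed.

(** Read this at the vertex being eliminated: [b] arcs leave for earlier vertices, [h] leave for
    later ones, [g] arrive from later ones; [L] and [L'] count the arcs among the [b] and the [g]
    that carry no gift, and [eps] marks the diagonal entry. Without rounding, 2/3 (b + h) - 2/3 b +
    4/3 g <= h + g just says g <= h; the slack 3 in the first hypothesis and the diagonal entry
    absorb the rounding. *)
Lemma gift_count (f b h g L L' : nat) (eps : bool) :
  (3 * f + 3 <= 2 * (b + h) -> g <= h -> L <= b -> L' <= g ->
   eps <= (g %% 3 == 2) -> 3 * (L + eps) <= b + (g %% 3 == 2) + 2 ->
   g + (g %% 3 == 2) <= 3 * (L' + eps) + 2 ->
   f - (b - L) + 2 * (g - L') <= h + g)%N.
Proof. by case: eqP; case: eps => /=; lia. Qed.

Lemma card_split1 (T : finType) (p q : pred T) (v : T) :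
  ~~ q v -> (forall w, p w -> w = v \/ q w) ->
  #|[set w | p w]| = (#|[set w | p w & q w]| + p v)%N.
Proof.
move=> qv pq; rewrite (cardsD1 v) inE addnC; congr (_ + _)%N; apply: eq_card => w.
rewrite !inE; case: eqVneq => [->|wv] /=; first by rewrite (negPf qv) andbF.
by case: (boolP (p w)) => //= /pq[/eqP|->//]; rewrite (negPf wv).
Qed.

Theorem theorem4 (T : finType) (e : rel T)
    (e_sym : symmetric e) (e_irr : irreflexive e) (F : T -> set nat) :
  (exists D : rel T, orientation e D /\
     forall v : T, finite_set (F v) /\
       (#|` fset_set (F v)|%fset)%:R <= 2 / 3 * (outdeg D v)%:R - 1 :> rat) ->
  exists D' : rel T, orientation e D' /\ avoiding F D'.
Proof.
case=> D [[sDe orD] FD].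
pose f v := #|` fset_set (F v)|%fset.
have f_bound v : (3 * f v + 3 <= 2 * outdeg D v)%N.
  have [_] := FD v; rewrite -/(f v) -(ler_nat rat) natrD !natrM; lra.
have D_irr v : D v v = false by apply/negP => /sDe; rewrite e_irr.
have [vs [vs_uniq vsT vsP]] := elimination_order D.
pose r v := index v vs.
pose g v := #|[set u | D u v & (r v < r u)%N]|.
(* The diagonal entry of [back] makes up for rounding when g v = 2 modulo 3: if X
   selects it, then v loses one arc less, which pays for one more gift when v is
   eliminated. *)
pose back u w := (u == w) && (g u %% 3 == 2)%N || D u w && (r w < r u)%N.
have [X [sXB rowX colX]] := third_subrel back.
(* Gifts are the arcs left out of [X]. A row of [X] keeps at most a third, rounded up, so [u] is
   compensated for about two thirds of the arcs it loses; a column keeps at least a third, rounded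
   down, so [v] gives to at most about two thirds of its later in-neighbors. *)
pose gifts v := [set u | (r v < r u)%N && (D u v && ~~ X u v)].
have Xback u w : X u w -> w = u \/ (r w < r u)%N.
  by case/sXB/orP => /andP[]; [move/eqP->; left | right].
have XD u w : X u w -> (r w < r u)%N -> D u w.
  by case/sXB/orP => /andP[] // /eqP-> _; rewrite ltnn.
have backv v : back v v = (g v %% 3 == 2)%N by rewrite /back eqxx D_irr orbF.
have giftsP pre v suf : vs = pre ++ v :: suf ->
    gifts v \subset [set w in suf | e v w] /\
    (f v - count (fun x => v \in gifts x) pre + 2 * #|gifts v|
      <= #|[set w in suf | e v w]|)%N.
  move=> eq_vs; have [rpre rsuf] : (forall x, (r x < r v)%N = (x \in pre)) /\
      (forall x, (r v < r x)%N = (x \in suf)).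
    have := vs_uniq; rewrite eq_vs => /index_split[rp rs].
    by split=> x; rewrite /r eq_vs ?rp // rs // -eq_vs.
  split.
    by apply/subsetP => u; rewrite !inE rsuf => /and3P[-> /sDe]; rewrite e_sym.
  pose b := #|[set w | D v w & (r w < r v)%N]|.
  pose h := #|[set u in suf | D v u]|.
  pose L := #|[set w | X v w & (r w < r v)%N]|.
  pose L' := #|[set u | X u v & (r v < r u)%N]|.
  have sL : [set w | X v w & (r w < r v)%N] \subset [set w | D v w & (r w < r v)%N].
    by apply/subsetP => w; rewrite !inE => /andP[/XD XDv rw]; rewrite rw XDv.
  have sL' : [set u | X u v & (r v < r u)%N] \subset [set u | D u v & (r v < r u)%N].
    by apply/subsetP => u; rewrite !inE => /andP[/XD XDv ru]; rewrite ru XDv.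
  have outE : outdeg D v = (b + h)%N.
    rewrite /outdeg -cardsE -(cardsID [set w | (r w < r v)%N]); congr (_ + _)%N.
      by apply: eq_card => w; rewrite !inE.
    apply: eq_card => w; rewrite !inE -leqNgt -rsuf leq_eqVlt.
    case: eqVneq => [rwv|//].
    have -> : w = v by apply: (index_inj v (vsT w) (vsT v)); apply: esym.
    by rewrite -topredE /= D_irr ltnn.
  have cardN : #|[set w in suf | e v w]| = (h + g v)%N.
    rewrite -(cardsID [set w | D v w]); congr (_ + _)%N; apply: eq_card => w; rewrite !inE.
      rewrite andbAC -andbA; congr (_ && _).
      by case: (boolP (D v w)) => [/sDe->|]; rewrite ?andbF.
    rewrite rsuf andbC -andbA andbC; congr (_ && _).
    have := orD v w; case: (boolP (e v w)) => [_ /(_ isT)|nevw _].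
      by case: (D v w); case: (D w v).
    by apply/esym/negP => /sDe; rewrite e_sym (negPf nevw).
  have giftsE : #|gifts v| = (g v - L')%N.
    rewrite -cardsDS //; apply: eq_card => u; rewrite !inE.
    by case: (r v < r u)%N; case: (D u v); case: (X u v).
  have countE : count (fun x => v \in gifts x) pre = (b - L)%N.
    rewrite -cardsDS // -size_filter.
    have /card_uniqP <- : uniq (filter (fun x => v \in gifts x) pre).
      by rewrite filter_uniq //; move: vs_uniq; rewrite eq_vs cat_uniq => /and3P[].
    apply: eq_card => w; rewrite mem_filter !inE -rpre.
    by case: (r w < r v)%N; case: (D v w); case: (X v w).
  rewrite countE giftsE cardN; apply: (@gift_count _ _ _ _ _ _ (X v v)).
  - by rewrite -outE.
  - have := vsP _ _ _ eq_vs; rewrite -/h; congr (_ <= _)%N; apply: eq_card => u.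
    by rewrite !inE rsuf andbC.
  - exact: subset_leq_card.
  - exact: subset_leq_card.
  - by rewrite -backv; case: (boolP (X v v)) => // /sXB->.
  - have <- : #|[set w | X v w]| = (L + X v v)%N.
      by apply: card_split1 => [|w /Xback]; rewrite ?ltnn.
    have <- // : #|[set w | back v w]| = (b + (g v %% 3 == 2))%N.
    rewrite -backv (@card_split1 _ _ (fun w => r w < r v)%N v) ?ltnn // => [|w].
      congr (_ + _)%N; apply: eq_card => w; rewrite !inE /back.
      by case: eqVneq => [<-|_] /=; [rewrite ltnn !andbF | rewrite -andbA andbb].
    by case/orP => /andP[]; [move/eqP->; left | right].
  - have <- : #|[set u | X u v]| = (L' + X v v)%N.
      by apply: (card_split1 (p := X^~ v)) => [|u /Xback[->|]]; rewrite ?ltnn; [|left|right].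
    have <- // : #|[set u | back u v]| = (g v + (g v %% 3 == 2))%N.
    rewrite -backv (@card_split1 _ (back^~ v) (fun u => r v < r u)%N v) ?ltnn // => [|u].
      congr (_ + _)%N; apply: eq_card => u; rewrite !inE /back.
      by case: eqVneq => [->|_] /=; [rewrite ltnn !andbF | rewrite -andbA andbb].
    by case/orP => /andP[]; [move/eqP->; left | right].
pose Fl v : seq rat := [seq c%:R | c <- fset_set (F v)].
have := @euler_functional_leading_monomial _ vs Fl vs_uniq.
set Phi := euler_functional _ => PhiL.
have [|D' [D'P D'or nz]] :=
  elimination e_sym e_irr vs_uniq (@euler_functionalD _ _) PhiL (gifts := gifts).
  by move=> pre v suf; rewrite size_map; apply: giftsP.
exists D'; split.
  split=> [u w /D'P/and3P[] //|u w euw]; exact: D'or.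
(* On the monomial of [D'] the functional is the product of the differences between outdegrees and
   forbidden values; a forbidden outdegree at [v] would make one factor zero. *)
move=> v Fv; move: nz; rewrite euler_functional_monomial prodf_seq_neq0.
have outE : #|[set u | D' v u]| = outdeg D' v.
  by rewrite /outdeg -cardsE; apply: eq_card => u; rewrite !inE.
move/allP/(_ (v, (outdeg D' v)%:R)); rewrite /= outE subrr eqxx => /(_ _)/negP[] //.
apply/allpairsPdep; exists v, (outdeg D' v)%:R; split=> //.
apply/mapP; exists (outdeg D' v) => //; rewrite in_fset_set; last by case: (FD v).
exact: mem_set.
Qed.
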